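(* Let $\pi\colon H\twoheadrightarrow G$ be an epimorphism of profinite groups, let $M_0(\pi)\ge M_1(\pi)\ge M_2(\pi)\ge\cdots$ be its fundament kernel series and put $G_i=H/M_i(\pi)$ for each $i\ge0$. Then $\bigcap_{i=0}^\infty M_i(\pi)=1$, and hence $H=\varprojlim_i G_i$.
   Context: Subgroups of profinite groups are closed, homomorphisms are continuous. For $M\triangleleft H$, $\mathcal{N}_M(H)$ is the set of maximal elements among the normal subgroups of $H$ strictly contained in $M$. The fundament kernel series of $\pi$ is defined inductively by $M_0(\pi)=\operatorname{Ker}\pi$ and, for $i\ge1$, $M_i(\pi)=\bigcap_{N\in\mathcal{N}_{M_{i-1}(\pi)}(H)}N$ (understood as $M_{i-1}(\pi)$ if $M_{i-1}(\pi)=1$, when the family is empty). The inverse limit is taken with respect to the quotient maps. *)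

(* Defs.v *)
From HB Require Import structures.
From mathcomp Require Import all_boot.
From mathcomp Require Import all_classical all_reals all_analysis.

Set Implicit Arguments.
Unset Strict Implicit.
Unset Printing Implicit Defensive.

Local Open Scope classical_set_scope.
Local Open Scope group_scope.
Local Open Scope quotient_scope.

HB.structure Definition PreTopologicalGroup := {G of Topological G & Group G}.

HB.mixin Record PreTopologicalGroup_isTopologicalGroup G
    of PreTopologicalGroup G := {
  mulg_continuous : continuous (fun x : G * G => x.1 * x.2 : G);
  invg_continuous : continuous (fun x : G => x^-1)
}.

#[short(type="topologicalGroupType")]
HB.structure Definition TopologicalGroup :=
  {G of PreTopologicalGroup G & PreTopologicalGroup_isTopologicalGroup G}.

HB.mixin Record TopologicalGroup_isProfinite G of TopologicalGroup G := {
  profinite_compact : compact [set: G];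
  profinite_hausdorff : hausdorff_space G;
  profinite_totally_disconnected : totally_disconnected [set: G]
}.

#[short(type="profiniteGroupType")]
HB.structure Definition ProfiniteGroup :=
  {G of TopologicalGroup G & TopologicalGroup_isProfinite G}.

#[short(type="topGroupHom")]
HB.structure Definition TopGroupHom (G H : topologicalGroupType) :=
  {f of @UMagmaMorphism G H f & @Continuous G H f}.

Definition topgroup_isomorphism (G H : topologicalGroupType)
    (f : topGroupHom G H) :=
  exists g : topGroupHom H G, cancel f g /\ cancel g f.

Record closed_normal_subgroup (G : topologicalGroupType) := ClosedNormal {
  cns_set :> set G;
  cns1 : cns_set 1;
  cnsM : forall x y, cns_set x -> cns_set y -> cns_set (x * y);
  cnsV : forall x, cns_set x -> cns_set x^-1;
  cnsJ : forall x y, cns_set x -> cns_set (x ^ y);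
  cns_closed : closed cns_set
}.

Section Kernel.
Context (H : topologicalGroupType) (G : profiniteGroupType).
Context (f : topGroupHom H G).

Let K : set H := f @^-1` [set 1].

Let fM x y : f (x * y) = f x * f y. Proof. exact: gmulfM. Qed.
Let fV x : f x^-1 = (f x)^-1. Proof. exact: gmulfV. Qed.

Fact kernel1 : K 1.
Proof. exact: gmulf1. Qed.

Fact kernelM x y : K x -> K y -> K (x * y).
Proof. by rewrite /K /= fM => -> ->; rewrite mulg1. Qed.

Fact kernelV x : K x -> K x^-1.
Proof. by rewrite /K /= fV => ->; rewrite invg1. Qed.

Fact kernelJ x y : K x -> K (x ^ y).
Proof. by rewrite /K /= /conjg !fM fV => ->; rewrite mul1g mulVg. Qed.

Fact kernel_closed : closed K.
Proof.
apply: closed_comp; first by move=> x _; exact: cts_fun.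
exact/accessible_closed_set1/hausdorff_accessible/profinite_hausdorff.
Qed.

Definition kernel : closed_normal_subgroup H :=
  ClosedNormal kernel1 kernelM kernelV kernelJ kernel_closed.

End Kernel.

Section Quotient.
Context (G : topologicalGroupType) (N : closed_normal_subgroup G).

Definition coset_rel (x y : G) : bool := `[< cns_set N (x^-1 * y) >].

Lemma coset_rel_refl : reflexive coset_rel.
Proof. by move=> x; apply/asboolP; rewrite mulVg; exact: cns1. Qed.

Lemma coset_rel_sym : symmetric coset_rel.
Proof.
suff h x y : coset_rel x y -> coset_rel y x by move=> x y; apply/idP/idP; exact: h.
by move=> /asboolP/cnsV Nxy; apply/asboolP; rewrite invgM invgK in Nxy.
Qed.

Lemma coset_rel_trans : transitive coset_rel.
Proof.
move=> y x z /asboolP Nxy /asboolP Nyz; apply/asboolP.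
by have := cnsM Nxy Nyz; rewrite mulgA mulgK.
Qed.

Canonical coset_equiv := EquivRel coset_rel
  coset_rel_refl coset_rel_sym coset_rel_trans.

Definition quotient_group := quotient_topology {eq_quot coset_equiv}.
HB.instance Definition _ := Topological.on quotient_group.
HB.instance Definition _ := Quotient.on quotient_group.

Definition coset_map (x : G) : quotient_group := \pi_quotient_group x.

Lemma coset_mapP x y : (coset_map x = coset_map y) <-> cns_set N (x^-1 * y).
Proof.
split=> [xy|Nxy].
  exact/asboolP/(@eqmodP G coset_equiv x y).
exact/(@eqmodP G coset_equiv x y)/asboolP.
Qed.

Lemma coset_map_surj (a : quotient_group) : exists x, coset_map x = a.
Proof. by exists (repr a); rewrite /coset_map reprK. Qed.

Definition quotient_one : quotient_group := coset_map 1.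
Definition quotient_mul (a b : quotient_group) : quotient_group :=
  coset_map (repr a * repr b).
Definition quotient_inv (a : quotient_group) : quotient_group :=
  coset_map (repr a)^-1.

Lemma repr_coset x : cns_set N (x^-1 * repr (coset_map x)).
Proof. by apply/coset_mapP; rewrite /coset_map reprK. Qed.

Lemma coset_mulE x y : quotient_mul (coset_map x) (coset_map y) = coset_map (x * y).
Proof.
apply/esym/coset_mapP.
set x' := repr (coset_map x); set y' := repr (coset_map y).
have -> : (x * y)^-1 * (x' * y') = (x^-1 * x') ^ y * (y^-1 * y').
  by rewrite /conjg invgM -!mulgA mulVKg.
by apply: cnsM; [apply: cnsJ|]; exact: repr_coset.
Qed.

Lemma coset_invE x : quotient_inv (coset_map x) = coset_map x^-1.
Proof.
apply/coset_mapP; set x' := repr _; rewrite invgK.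
have -> : x' * x^-1 = (x^-1 * x') ^ x^-1.
  by rewrite /conjg invgK -!mulgA mulVKg.
exact/cnsJ/repr_coset.
Qed.

Fact quotient_mulA : associative quotient_mul.
Proof.
move=> a b c.
have [[[x <-] [y <-]] [z <-]] :=
  (coset_map_surj a, coset_map_surj b, coset_map_surj c).
by rewrite !coset_mulE mulgA.
Qed.

Fact quotient_mul1 : left_id quotient_one quotient_mul.
Proof. by move=> a; have [x <-] := coset_map_surj a; rewrite coset_mulE mul1g. Qed.

Fact quotient_1mul : right_id quotient_one quotient_mul.
Proof. by move=> a; have [x <-] := coset_map_surj a; rewrite coset_mulE mulg1. Qed.

Fact quotient_mulV : left_inverse quotient_one quotient_inv quotient_mul.
Proof.
move=> a; have [x <-] := coset_map_surj a.
by rewrite coset_invE coset_mulE mulVg.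
Qed.

Fact quotient_Vmul : right_inverse quotient_one quotient_inv quotient_mul.
Proof.
move=> a; have [x <-] := coset_map_surj a.
by rewrite coset_invE coset_mulE mulgV.
Qed.

HB.instance Definition _ := isGroup.Build quotient_group
  quotient_mulA quotient_mul1 quotient_1mul quotient_mulV quotient_Vmul.

Lemma coset_map_continuous : continuous coset_map.
Proof. exact: pi_continuous. Qed.

End Quotient.

Section QuotientTopology.
Context (G : topologicalGroupType) (N : closed_normal_subgroup G).
Local Notation Q := (quotient_group N).

Lemma coset_mapM x y : coset_map N (x * y) = coset_map N x * coset_map N y.
Proof. exact/esym/coset_mulE. Qed.

Lemma coset_mapV x : coset_map N x^-1 = (coset_map N x)^-1.
Proof. exact/esym/coset_invE. Qed.

Lemma mulg_continuousl (g : G) : continuous (fun x : G => x * g).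
Proof.
move=> x; apply: (@continuous_comp _ _ _ (fun x : G => (x, g))
  (fun p : G * G => p.1 * p.2)); last exact: mulg_continuous.
by apply: cvg_pair; [exact: cvg_id|exact: cvg_cst].
Qed.

Lemma coset_map_open (U : set G) : open U -> open (@coset_map G N @` U).
Proof.
move=> oU; rewrite [open _]/(open (@coset_map G N @^-1` _)).
rewrite (_ : _ @^-1` _ =
    \bigcup_(n in cns_set N) ((fun x : G => x * n) @^-1` U)).
  by apply: bigcup_open => n _; apply: open_comp => // x _; exact: mulg_continuousl.
apply/seteqP; split=> x /=.
  by move=> [y Uy /esym/coset_mapP Nxy]; exists (x^-1 * y) => //=; rewrite mulVKg.
move=> [n Nn /= Uxn]; exists (x * n) => //.
by apply/esym/coset_mapP; rewrite mulKg.
Qed.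

Lemma coset_map_nbhs (x : G) (U : set G) :
  nbhs x U -> nbhs (coset_map N x) (coset_map N @` U).
Proof.
rewrite nbhsE => -[V [oV Vx] VU].
apply: (@filterS _ _ _ (coset_map N @` V)); first exact: image_subset.
by apply: open_nbhs_nbhs; split; [exact: coset_map_open|exists x].
Qed.

Fact quotient_mul_continuous : continuous (fun x : Q * Q => x.1 * x.2 : Q).
Proof.
move=> [a b]; have [[x <-] [y <-]] := (coset_map_surj a, coset_map_surj b).
move=> U /=; rewrite -coset_mapM => /(@coset_map_continuous G N).
move=> /(@mulg_continuous G (x, y)) [[V W] /= [Vx Wy] VWU].
exists (coset_map N @` V, coset_map N @` W).
  by split; exact: coset_map_nbhs.
move=> [_ _] /= [[v Vv <-] [w Ww <-]].
by rewrite -coset_mapM; exact: (VWU (v, w)).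
Qed.

Fact quotient_inv_continuous : continuous (fun x : Q => x^-1).
Proof.
move=> a; have [x <-] := coset_map_surj a.
move=> U /=; rewrite -coset_mapV => /(@coset_map_continuous G N).
move=> /(@invg_continuous G x) /= /coset_map_nbhs.
rewrite nbhs_simpl /=; apply: filterS => _ [v Uv <-].
by rewrite /= -coset_mapV.
Qed.

HB.instance Definition _ := PreTopologicalGroup_isTopologicalGroup.Build Q
  quotient_mul_continuous quotient_inv_continuous.

End QuotientTopology.

Section CosetMap.
Context (G : topologicalGroupType).

Fact coset_map_morph (N : closed_normal_subgroup G) :
  monoid_morphism (coset_map N).
Proof. by split=> // x y; exact: coset_mapM. Qed.

HB.instance Definition _ N :=
  isUMagmaMorphism.Build _ _ (coset_map N) (coset_map_morph N).
HB.instance Definition _ N :=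
  isContinuous.Build _ _ (coset_map N) (@coset_map_continuous G N).

Definition quotient_map (N M : closed_normal_subgroup G) (NM : N `<=` M)
  (a : quotient_group N) : quotient_group M := coset_map M (repr a).

Context (N M : closed_normal_subgroup G) (NM : N `<=` M).

Lemma quotient_mapE x : quotient_map NM (coset_map N x) = coset_map M x.
Proof. exact/esym/coset_mapP/NM/repr_coset. Qed.

Fact quotient_map_morph : monoid_morphism (quotient_map NM).
Proof.
split=> [|a b]; first exact: quotient_mapE.
have [[x <-] [y <-]] := (coset_map_surj a, coset_map_surj b).
by rewrite -coset_mapM !quotient_mapE coset_mapM.
Qed.

Fact quotient_map_continuous : continuous (quotient_map NM).
Proof.
apply/quotient_continuous; rewrite (_ : _ \o _ = coset_map M).
  exact: coset_map_continuous.
by apply/funext => x /=; exact: quotient_mapE.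
Qed.

HB.instance Definition _ :=
  isUMagmaMorphism.Build _ _ (quotient_map NM) quotient_map_morph.
HB.instance Definition _ :=
  isContinuous.Build _ _ (quotient_map NM) quotient_map_continuous.

End CosetMap.

Record inverse_system := InverseSystem {
  inv_obj :> nat -> topologicalGroupType;
  inv_map : forall i j, (i <= j)%N -> topGroupHom (inv_obj j) (inv_obj i);
  inv_map_id : forall i (ii : (i <= i)%N) x, inv_map ii x = x;
  inv_map_comp : forall i j k (ij : (i <= j)%N) (jk : (j <= k)%N)
    (ik : (i <= k)%N) x, inv_map ij (inv_map jk x) = inv_map ik x
}.

Section ProductGroup.
Context (I : eqType) (K : I -> topologicalGroupType).
Local Notation P := (prod_topology K).

Let pmul (x y : P) : P := fun i => x i * y i.
Let pone : P := fun i => 1.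
Let pinv (x : P) : P := fun i => (x i)^-1.

Fact prod_mulA : associative pmul.
Proof.
by move=> x y z; apply: functional_extensionality_dep => i; exact: mulgA.
Qed.

Fact prod_mul1 : left_id pone pmul.
Proof. by move=> x; apply: functional_extensionality_dep => i; exact: mul1g. Qed.

Fact prod_1mul : right_id pone pmul.
Proof. by move=> x; apply: functional_extensionality_dep => i; exact: mulg1. Qed.

Fact prod_mulV : left_inverse pone pinv pmul.
Proof. by move=> x; apply: functional_extensionality_dep => i; exact: mulVg. Qed.

Fact prod_Vmul : right_inverse pone pinv pmul.
Proof. by move=> x; apply: functional_extensionality_dep => i; exact: mulgV. Qed.

HB.instance Definition _ := isGroup.Build P
  prod_mulA prod_mul1 prod_1mul prod_mulV prod_Vmul.

Lemma prod_continuous (T : topologicalType) (f : T -> P) :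
  (forall i, continuous (fun t => f t i)) -> continuous f.
Proof.
move=> cf t; apply/cvg_sup => i U [_ [[V oV <-] /= Vt] VU].
apply: filterS VU _; apply: (cf i t); exact: open_nbhs_nbhs.
Qed.

Fact prod_mul_continuous : continuous (fun x : P * P => x.1 * x.2 : P).
Proof.
apply: prod_continuous => i x /=.
apply: (@continuous_comp _ _ _ (fun x : P * P => (x.1 i, x.2 i))
  (fun p : K i * K i => p.1 * p.2)); last exact: mulg_continuous.
apply: cvg_pair.
  apply: (@continuous_comp _ _ _ fst (fun y : P => y i)); first exact: cvg_fst.
  exact: proj_continuous.
apply: (@continuous_comp _ _ _ snd (fun y : P => y i)); first exact: cvg_snd.
exact: proj_continuous.
Qed.

Fact prod_inv_continuous : continuous (fun x : P => x^-1).
Proof.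
apply: prod_continuous => i x /=.
apply: (@continuous_comp _ _ _ (fun y : P => y i) (fun y : K i => y^-1)).
  exact: proj_continuous.
exact: invg_continuous.
Qed.

HB.instance Definition _ := PreTopologicalGroup_isTopologicalGroup.Build P
  prod_mul_continuous prod_inv_continuous.

End ProductGroup.

Section InverseLimit.
Context (S : inverse_system).
Local Notation P := (prod_topology (fun i => inv_obj S i)).

Definition compatible : set P :=
  [set x | forall i j (ij : (i <= j)%N), inv_map S ij (x j) = x i].

Fact compatible_closed : group_closed (fun x => x \in compatible).
Proof.
split=> [|x y /set_mem xc /set_mem yc]; apply/mem_set => i j ij.
  exact: gmulf1.
by rewrite [LHS]gmulfM [X in _ * X]gmulfV; congr (_ / _); [exact: xc|exact: yc].
Qed.

Definition inverse_limit : Type := set_type compatible.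
HB.instance Definition _ := Topological.on inverse_limit.
HB.instance Definition _ := SubChoice.on inverse_limit.
HB.instance Definition _ := SubChoice_isSubGroup.Build
  P (fun x => x \in compatible) inverse_limit compatible_closed.

Lemma inverse_limit_continuous (T : topologicalType) (f : T -> inverse_limit) :
  (forall i, continuous (fun t => (\val (f t) : P) i)) -> continuous f.
Proof.
move=> cf t U [_ [[V oV <-] /= Vt] VU].
apply: filterS VU _.
by apply: (prod_continuous cf); exact: open_nbhs_nbhs.
Qed.

Definition inverse_limit_proj (i : nat) (x : inverse_limit) : inv_obj S i :=
  (\val x : P) i.

Lemma inverse_limit_proj_continuous i : continuous (inverse_limit_proj i).
Proof.
move=> x.
apply: (@continuous_comp _ _ _ (\val : inverse_limit -> P) (fun y : P => y i)).
  exact: initial_continuous.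
exact: proj_continuous.
Qed.

Fact inverse_limit_mul_continuous :
  continuous (fun x : inverse_limit * inverse_limit => x.1 * x.2 : inverse_limit).
Proof.
apply: inverse_limit_continuous => i x.
apply: (@continuous_comp _ _ _
  (fun x => (inverse_limit_proj i x.1, inverse_limit_proj i x.2))
  (fun p : S i * S i => p.1 * p.2)); last exact: mulg_continuous.
apply: cvg_pair.
  apply: (@continuous_comp _ _ _ fst (inverse_limit_proj i)); first exact: cvg_fst.
  exact: inverse_limit_proj_continuous.
apply: (@continuous_comp _ _ _ snd (inverse_limit_proj i)); first exact: cvg_snd.
exact: inverse_limit_proj_continuous.
Qed.

Fact inverse_limit_inv_continuous : continuous (fun x : inverse_limit => x^-1).
Proof.
apply: inverse_limit_continuous => i x.
apply: (@continuous_comp _ _ _ (inverse_limit_proj i) (fun y : S i => y^-1)).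
  exact: inverse_limit_proj_continuous.
exact: invg_continuous.
Qed.

HB.instance Definition _ := PreTopologicalGroup_isTopologicalGroup.Build
  inverse_limit inverse_limit_mul_continuous inverse_limit_inv_continuous.

End InverseLimit.

Section QuotientSystem.
Context (H : topologicalGroupType) (M : nat -> closed_normal_subgroup H).
Context (decrM : forall i j, (i <= j)%N -> M j `<=` M i).

Fact quotient_map_id i (ii : (i <= i)%N) (a : quotient_group (M i)) :
  quotient_map (decrM ii) a = a.
Proof. by have [x <-] := coset_map_surj a; rewrite quotient_mapE. Qed.

Fact quotient_map_comp i j k (ij : (i <= j)%N) (jk : (j <= k)%N)
    (ik : (i <= k)%N) (a : quotient_group (M k)) :
  quotient_map (decrM ij) (quotient_map (decrM jk) a) = quotient_map (decrM ik) a.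
Proof. by have [x <-] := coset_map_surj a; rewrite !quotient_mapE. Qed.

Definition quotient_system : inverse_system :=
  @InverseSystem (fun i => quotient_group (M i))
    (fun i j ij => quotient_map (decrM ij))
    quotient_map_id quotient_map_comp.

Fact coset_seq_compatible (h : H) :
  (fun i => coset_map (M i) h) \in @compatible quotient_system.
Proof. by apply/mem_set => i j ij; exact: quotient_mapE. Qed.

Definition to_inverse_limit (h : H) : inverse_limit quotient_system :=
  @exist _ (fun x => x \in @compatible quotient_system) _
    (coset_seq_compatible h).

Fact to_inverse_limit_morph : monoid_morphism to_inverse_limit.
Proof.
split=> [|x y]; apply: val_inj; apply: functional_extensionality_dep => i //.
exact: coset_mapM.
Qed.

Fact to_inverse_limit_continuous : continuous to_inverse_limit.
Proof. by apply: inverse_limit_continuous => i; exact: coset_map_continuous. Qed.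

HB.instance Definition _ :=
  isUMagmaMorphism.Build _ _ to_inverse_limit to_inverse_limit_morph.
HB.instance Definition _ :=
  isContinuous.Build _ _ to_inverse_limit to_inverse_limit_continuous.

End QuotientSystem.

Section Fundament.
Context (H : topologicalGroupType).
Implicit Types M N L : closed_normal_subgroup H.

(* Subgroups of profinite groups are closed by convention, so both N and its
   competitors L range over the closed normal subgroups of H. *)
Definition max_normal_below M : set (closed_normal_subgroup H) :=
  [set N | cns_set N `<` M /\
    forall L, cns_set L `<` M -> N `<=` L -> cns_set L = N].

Section FundamentSubgroup.
Context (M : closed_normal_subgroup H).

(* The factor M matters only for the empty family, whose intersection is by
   convention M; see fundament_bigcap, fundament_empty and
   max_normal_below_trivial. *)
Let F : set H := M `&` \bigcap_(N in max_normal_below M) cns_set N.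

Fact fundament1 : F 1.
Proof. by split=> [|N _]; exact: cns1. Qed.

Fact fundamentM x y : F x -> F y -> F (x * y).
Proof.
move=> [Mx Nx] [My Ny]; split=> [|N MN]; first exact: cnsM.
by apply: cnsM; [exact: Nx|exact: Ny].
Qed.

Fact fundamentV x : F x -> F x^-1.
Proof.
by move=> [Mx Nx]; split=> [|N MN]; apply: cnsV => //; exact: Nx.
Qed.

Fact fundamentJ x y : F x -> F (x ^ y).
Proof.
by move=> [Mx Nx]; split=> [|N MN]; apply: cnsJ => //; exact: Nx.
Qed.

Fact fundament_closed : closed F.
Proof.
apply: closedI; first exact: cns_closed.
by apply: closed_bigI => N _; exact: cns_closed.
Qed.

Definition fundament : closed_normal_subgroup H :=
  ClosedNormal fundament1 fundamentM fundamentV fundamentJ fundament_closed.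

Lemma fundament_sub : fundament `<=` M.
Proof. by move=> x []. Qed.

Lemma fundament_bigcap : max_normal_below M !=set0 ->
  cns_set fundament = \bigcap_(N in max_normal_below M) cns_set N.
Proof.
move=> [N MN]; apply: setIidr => x /(_ N MN) Nx.
by case: MN => -[NM _] _; exact: NM.
Qed.

Lemma fundament_empty : max_normal_below M = set0 -> cns_set fundament = M.
Proof. by rewrite /= /F => ->; rewrite bigcap_set0 setIT. Qed.

Lemma max_normal_below_trivial :
  cns_set M = [set 1] -> max_normal_below M = set0.
Proof.
move=> M1; apply/seteqP; split=> // N [[_ MN] _]; apply: MN.
by rewrite M1 => _ ->; exact: cns1.
Qed.

End FundamentSubgroup.
End Fundament.

Section FundamentKernelSeries.
Context (H G : profiniteGroupType) (f : topGroupHom H G).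

Fixpoint fundament_kernel (i : nat) : closed_normal_subgroup H :=
  if i is i'.+1 then fundament (fundament_kernel i') else kernel f.

Lemma fundament_kernel_decr i j :
  (i <= j)%N -> fundament_kernel j `<=` fundament_kernel i.
Proof.
elim: j => [|j IHj]; first by rewrite leqn0 => /eqP ->.
rewrite leq_eqVlt => /predU1P[-> //|/IHj]; apply: subset_trans.
exact: fundament_sub.
Qed.

End FundamentKernelSeries.

Arguments fundament_kernel_decr {H G} f [i j] _.

(* Main.v *)
Require Import Defs.
From HB Require Import structures.
From mathcomp Require Import all_boot.
From mathcomp Require Import all_classical all_reals all_analysis.

Set Implicit Arguments.
Unset Strict Implicit.
Unset Printing Implicit Defensive.

Local Open Scope classical_set_scope.
Local Open Scope group_scope.

(** The family of open normal subgroups S of H is a basis of neighbourhoods of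
    1, so both claims follow once every such S contains some M_n
    ([fundament_kernel_cofinal]).

    Suppose that M_i is not contained in S. As H/S is finite, among the closed
    normal subgroups of H lying strictly below M_i and containing M_i `&` S there
    is one, N, that meets the largest number of cosets of S
    ([coset_counting]). It is maximal below M_i: if N <= L < M_i and L meets no
    more cosets than N does, then every element of L is a product n s with n in N
    and s in S, hence s lies in M_i `&` S and so in N ([cns_modular]). Therefore
    M_(i+1) <= N. If M_(i+1) met as many cosets of S as M_i does, the same
    computation would give M_i <= N, a contradiction. So each M_i not contained in
    S meets strictly more cosets of S than M_(i+1), and this can happen only
    finitely often.

    The intersection of the M_i then lies in every neighbourhood of 1, so it is
    trivial since H is Hausdorff; this is injectivity of the map from H to the
    inverse limit. Its surjectivity is compactness: representatives of the
    coordinates of a compatible family form a sequence in H, and any cluster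
    point of it maps to the family. The inverse map is continuous because
    membership in a basic neighbourhood h S of h is decided by the n-th
    coordinate as soon as M_n <= S.

    That the open normal subgroups form a basis rests on two compactness
    arguments: in a compact Hausdorff space the quasi-components are connected,
    so a totally disconnected one has a basis of clopen sets; and in a compact
    group the two-sided stabilizer of a clopen set is open. *)

(** * Clopen sets in compact totally disconnected spaces *)

Section QuasiComponent.
Context (T : topologicalType) (x : T).

Definition quasi_component : set T :=
  \bigcap_(C in [set C : set T | clopen C /\ C x]) C.

Lemma quasi_component_closed : closed quasi_component.
Proof. by apply: closed_bigI => C [[]]. Qed.

(** The traces on F of the clopen neighbourhoods of x are closed under finite
    intersection; if none were empty, a cluster point in F would lie in every
    one of these clopen sets. *)
Lemma clopen_disjoint_quasi_component (F : set T) : compact F ->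
  F `&` quasi_component = set0 ->
  exists C : set T, [/\ clopen C, C x & F `&` C = set0].
Proof.
move=> cF FQ; apply: contrapT => noC.
pose G := filter_from [set C : set T | clopen C /\ C x] (setI F).
have FG : Filter G.
  apply: filter_from_filter; first by exists setT; split; [exact: clopenT|].
  move=> A B [clA Ax] [clB Bx]; exists (A `&` B).
    by split; [exact: clopenI|].
  by move=> y [Fy [Ay By]].
have PG : ProperFilter G.
  apply: filter_from_proper => C [clC Cx].
  by apply/set0P/eqP => FC; apply: noC; exists C.
have [|p [Fp clp]] := cF G PG.
  by exists setT => [|y []//]; split; [exact: clopenT|].
suff : (F `&` quasi_component) p by rewrite FQ.
split=> // C [[oC cC] Cx]; apply: (cC) => V Vp.
have [|y [[Fy Cy] Vy]] := clp (F `&` C) V _ Vp; last by exists y.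
by exists C.
Qed.

(** Take a relatively clopen part P of the quasi-component Q that contains x,
    with complement B in Q. By normality some open V contains P and has closure
    disjoint from B, so its boundary misses Q and some clopen C containing x
    misses that boundary. Then C `&` V is clopen, hence contains Q, and B is
    empty. *)
Lemma quasi_component_connected :
  hausdorff_space T -> compact [set: T] -> connected quasi_component.
Proof.
move=> hT cT.
(* A part that misses x is replaced by its complement. *)
suff main (P : set T) : P x ->
    (exists2 C, open C & P = quasi_component `&` C) ->
    (exists2 C, closed C & P = quasi_component `&` C) ->
    P = quasi_component.
  move=> P [p Pp] Po Pc.
  have [Px|nPx] := pselect (P x); first exact: main.
  have : quasi_component `\` P = quasi_component.
    apply: main; first by split=> // C [].
    - have [C cC ->] := Pc; exists (~` C); first exact: closed_openC.
      by rewrite setDIr setDv set0U setDE.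
    - have [C oC ->] := Po; exists (~` C); first exact: open_closedC.
      by rewrite setDIr setDv set0U setDE.
  move=> QP; have : (quasi_component `\` P) p.
    by rewrite QP; have [C _ PE] := Po; move: Pp; rewrite PE => -[].
  by case.
move=> Px [C1 oC1 PE1] [C2 cC2 PE2].
have cP : closed P.
  by rewrite PE2; apply: closedI => //; exact: quasi_component_closed.
pose B := quasi_component `&` ~` C1.
have cB : closed B.
  by apply: closedI; [exact: quasi_component_closed|exact: open_closedC].
have [|W PW WB] := @compact_normal T hT cT P cP (~` B).
  apply/set_nbhsP; exists (~` B); split=> //; first exact: closed_openC.
  by rewrite PE1 => y [_ C1y] [_].
have [V [oV PV VW]] := (iffLR (set_nbhsP _ _) PW).
have VB y : closure V y -> ~ B y by move=> /(closureS VW)/WB.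
have [C [[oC cC] Cx FC]] :
    exists C : set T, [/\ clopen C, C x & (closure V `\` V) `&` C = set0].
  apply: clopen_disjoint_quasi_component.
    apply: (@subclosed_compact _ _ setT) => //; rewrite setDE.
    by apply: closedI; [exact: closed_closure|exact: open_closedC].
  apply/seteqP; split=> // y [[cVy nVy] Qy].
  by apply: nVy; apply: PV; rewrite PE1; split=> //;
    apply: contrapT => nC1y; exact: (VB y).
have CVE : C `&` V = C `&` closure V.
  apply/seteqP; split=> y [Cy Vy]; split=> //; first exact: subset_closure.
  apply: contrapT => nVy.
  suff : ((closure V `\` V) `&` C) y by rewrite FC.
  by [].
have QV : quasi_component `<=` V.
  move=> y /(_ (C `&` V)) []//; split; last by split=> //; exact: PV.
  split; first exact: openI.
  by rewrite CVE; apply: closedI => //; exact: closed_closure.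
apply/seteqP; split=> y; first by rewrite PE1 => -[].
move=> Qy; rewrite PE1; split=> //; apply: contrapT => nC1y.
by apply: (VB y) => //; apply/subset_closure/QV.
Qed.

End QuasiComponent.

Lemma compact_totally_disconnected_zero_dimensional (T : topologicalType) :
  hausdorff_space T -> compact [set: T] -> totally_disconnected [set: T] ->
  zero_dimensional T.
Proof.
move=> hT cT dT x y xy; apply: contrapT => noU.
have : quasi_component x `<=` [set x].
  rewrite -(dT x I); apply: connected_component_max => //.
    by move=> C [].
  exact: quasi_component_connected.
move=> /(_ y) yx; have : y = x; last by move=> /esym/eqP; rewrite (negbTE xy).
by apply: yx => C [clC Cx]; apply: contrapT => nCy; apply: noU; exists C.
Qed.

(** * Open normal subgroups of a profinite group *)

(** The elements g that can be inserted anywhere in a product without changing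
    whether the product lies in A form a normal subgroup. Allowing factors on
    both sides is what makes this set invariant under conjugation. *)
Section TwoSidedStabilizer.
Context (H : topologicalGroupType) (A : set H).

Definition two_sided_stabilizer : set H :=
  [set g | forall a b, A (a * g * b) <-> A (a * b)].
Local Notation S := two_sided_stabilizer.

Lemma two_sided_stabilizer1 : S 1.
Proof. by move=> a b; rewrite mulg1. Qed.

Lemma two_sided_stabilizerM x y : S x -> S y -> S (x * y).
Proof.
move=> Sx Sy a b.
have -> : a * (x * y) * b = a * x * y * b by rewrite !mulgA.
by rewrite (Sy (a * x)) Sx.
Qed.

Lemma two_sided_stabilizerV x : S x -> S x^-1.
Proof. by move=> Sx a b; rewrite -Sx mulgVK. Qed.

Lemma two_sided_stabilizerJ x y : S x -> S (x ^ y).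
Proof.
move=> Sx a b.
have -> : a * x ^ y * b = (a * y^-1) * x * (y * b).
  by rewrite /conjg !mulgA.
by rewrite Sx mulgA mulgVK.
Qed.

Lemma two_sided_stabilizer_sub : A 1 -> S `<=` A.
Proof. by move=> A1 g /(_ 1 1); rewrite mul1g !mulg1 => ->. Qed.

Lemma mul3g_continuous (p : (H * H) * H) :
  {for p, continuous (fun p : (H * H) * H => p.1.1 * p.2 * p.1.2)}.
Proof.
apply: (@continuous_comp _ _ _ (fun p : (H * H) * H => (p.1.1 * p.2, p.1.2))
  (fun q : H * H => q.1 * q.2)); last exact: mulg_continuous.
apply: cvg_pair.
  apply: (@continuous_comp _ _ _ (fun p : (H * H) * H => (p.1.1, p.2))
    (fun q : H * H => q.1 * q.2)); last exact: mulg_continuous.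
  apply: cvg_pair; last exact: cvg_snd.
  by apply: (@continuous_comp _ _ _ fst fst); exact: cvg_fst.
by apply: (@continuous_comp _ _ _ fst snd); [exact: cvg_fst|exact: cvg_snd].
Qed.

(** Since A is clopen, the defining equivalence holds for (a', b', g) near
    (a, b, 1), whatever a and b are; compactness of H * H makes the
    neighbourhood of 1 uniform in (a, b). *)
Lemma two_sided_stabilizer_nbhs1 :
  compact [set: H] -> clopen A -> nbhs 1 S.
Proof.
move=> cH [oA cA].
have cHH : compact [set: H * H] by rewrite -setXTT; exact: compact_setX.
move/compact_near_coveringP/(_ H (nbhs (1 : H))
  (fun g (p : H * H) => A (p.1 * g * p.2) <-> A (p.1 * p.2)) _) : cHH.
move=> near1; apply: filterS (near1 _) => [g Ag a b|[a b] _].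
  exact: (Ag (a, b)).
have near_in (B : set H) : open B -> B (a * b) ->
    nbhs ((a, b), 1 : H)
      [set q : (H * H) * H | B (q.1.1 * q.2 * q.1.2) /\ B (q.1.1 * q.1.2)].
  move=> oB Bab; apply: filterI.
    apply: (@mul3g_continuous ((a, b), 1)) => /=.
    by rewrite mulg1; exact: open_nbhs_nbhs.
  apply: (@continuous_comp _ _ _ fst (fun q : H * H => q.1 * q.2)
    ((a, b), 1 : H)); [exact: cvg_fst|exact: mulg_continuous|].
  exact: open_nbhs_nbhs.
have [Aab|nAab] := pselect (A (a * b)).
  by apply: filterS (near_in A oA Aab) => q [].
by apply: filterS (near_in (~` A) (closed_openC cA) nAab) => q [].
Qed.

End TwoSidedStabilizer.

Lemma mulg_continuousr (G : topologicalGroupType) (g : G) :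
  continuous (fun x : G => g * x).
Proof.
move=> x; apply: (@continuous_comp _ _ _ (fun x : G => (g, x))
  (fun p : G * G => p.1 * p.2)); last exact: mulg_continuous.
by apply: cvg_pair; [exact: cvg_cst|exact: cvg_id].
Qed.

Lemma coset_nbhs (G : topologicalGroupType) (S : set G) (x : G) :
  nbhs 1 S -> nbhs x [set y | S (x^-1 * y)].
Proof. by move=> S1; apply: mulg_continuousr; rewrite mulVg. Qed.

(** A coset of S that meets S is S, and every point of the closure of S has its
    coset as a neighbourhood. *)
Lemma subgroup_nbhs1_closed (G : topologicalGroupType) (S : set G) :
  (forall x y, S x -> S y -> S (x * y)) -> (forall x, S x -> S x^-1) ->
  nbhs 1 S -> closed S.
Proof.
move=> SM SV S1 x /(_ _ (coset_nbhs x S1)) [y [Sy Sxy]].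
by rewrite -(mulgK (x^-1 * y) x) mulVKg; apply: SM => //; exact: SV.
Qed.

Lemma open_normal_subgroup_basis (H : profiniteGroupType) (U : set H) :
  nbhs 1 U -> exists S : closed_normal_subgroup H, nbhs 1 S /\ S `<=` U.
Proof.
move=> U1.
have [A [A1 clA] AU] : filter_from [set D : set H | D 1 /\ clopen D] id U.
  apply: zero_dimensional_cvg U1.
  - exact: profinite_hausdorff.
  - apply: compact_totally_disconnected_zero_dimensional.
    + exact: profinite_hausdorff.
    + exact: profinite_compact.
    + exact: profinite_totally_disconnected.
  - exact: profinite_compact.
have S1 := two_sided_stabilizer_nbhs1 (@profinite_compact H) clA.
have cS := subgroup_nbhs1_closed (@two_sided_stabilizerM _ A)
  (@two_sided_stabilizerV _ A) S1.
exists (ClosedNormal (@two_sided_stabilizer1 _ A) (@two_sided_stabilizerM _ A)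
  (@two_sided_stabilizerV _ A) (@two_sided_stabilizerJ _ A) cS).
split=> //; exact: subset_trans (two_sided_stabilizer_sub A1) AU.
Qed.

(** * Maximal normal subgroups and the cofinality of the series *)

Lemma compact_finite_cosets (H : topologicalGroupType) (S : set H) :
  compact [set: H] -> nbhs 1 S ->
  exists X : seq H, forall h, exists2 x, x \in X & S (x^-1 * h).
Proof.
move=> cH S1.
(* The tails of the finite sequences directed by inclusion: covering H by the
   cosets of a sequence holds for F as soon as each point is covered. *)
pose F := filter_from [set: seq H] (fun X => [set Y : seq H | {subset X <= Y}]).
have FF : Filter F.
  apply: filter_from_filter; first by exists [::].
  move=> X Y _ _; exists (X ++ Y) => // Z XYZ.
  by split=> x xX; apply: XYZ; rewrite mem_cat xX ?orbT.
have /compact_near_coveringP/(_ _ F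
  (fun X h => exists2 x, x \in X & S (x^-1 * h)) FF) := cH.
case=> [h _|X _ XP].
  exists ([set y | S (h^-1 * y)], [set Y : seq H | {subset [:: h] <= Y}]) => /=.
    by split; [exact: coset_nbhs|exists [:: h]].
  by move=> [y Y] /= [Sy hY]; exists h => //; apply: hY; rewrite mem_head.
by exists X => h; apply: (XP X).
Qed.

(** The witness c L counts, in a fixed finite list of cosets of S covering H,
    those that meet L. For a subgroup L and a list without repetitions this is
    the order of L S / S, but it makes sense for any set, so that no quotient or
    product of subgroups has to be formed; the last clause says L' <= L S. *)
Lemma coset_counting (H : topologicalGroupType) (S : closed_normal_subgroup H) :
  compact [set: H] -> nbhs 1 S ->
  exists (n : nat) (c : set H -> nat), (forall L, c L <= n)%N /\
    forall L L', L `<=` L' -> (c L <= c L')%N /\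
      ((c L' <= c L)%N -> forall y, L' y -> exists2 l, L l & cns_set S (l^-1 * y)).
Proof.
move=> cH S1; have [X XP] := compact_finite_cosets cH S1.
pose x i := tnth (in_tuple X) i.
pose c (L : set H) :=
  [set i : 'I_(size X) | `[< exists2 l, L l & cns_set S ((x i)^-1 * l) >]]%SET.
exists (size X), (fun L => #|c L|); split=> [L|L L' LL'].
  by rewrite -[X in (_ <= X)%N](card_ord (size X)) max_card.
have cLL' : c L \subset c L'.
  apply/fintype.subsetP => i; rewrite !finset.in_set => /asboolP[l Ll Sl].
  by apply/asboolP; exists l => //; exact: LL'.
split; first exact: subset_leq_card.
move=> cL'L y L'y; have [_ /(tnthP (in_tuple X))[i ->] Siy] := XP y.
have : i \in c L' by rewrite finset.in_set; apply/asboolP; exists y.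
have /eqP <- : c L == c L' by rewrite eqEcard cLL'.
rewrite finset.in_set => /asboolP[l Ll Sil]; exists l => //.
have := cnsM (cnsV Sil) Siy.
by rewrite invgM invgK -mulgA mulVKg.
Qed.

Section Meet.
Context (H : topologicalGroupType) (M N : closed_normal_subgroup H).
Let I : set H := M `&` N.

Let I1 : I 1. Proof. by split; exact: cns1. Qed.
Let IM x y : I x -> I y -> I (x * y).
Proof. by move=> [? ?] [? ?]; split; exact: cnsM. Qed.
Let IV x : I x -> I x^-1.
Proof. by move=> [? ?]; split; exact: cnsV. Qed.
Let IJ x y : I x -> I (x ^ y).
Proof. by move=> [? ?]; split; exact: cnsJ. Qed.
Let I_closed : closed I.
Proof. by apply: closedI; exact: cns_closed. Qed.

Definition cns_meet : closed_normal_subgroup H := ClosedNormal I1 IM IV IJ I_closed.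
End Meet.

(** Dedekind's modular law: M <= N S and N <= M give M = N (M `&` S). *)
Lemma cns_modular (H : topologicalGroupType) (M N S : closed_normal_subgroup H) :
  N `<=` M -> M `&` S `<=` N ->
  (forall y, cns_set M y -> exists2 l, cns_set N l & cns_set S (l^-1 * y)) ->
  M `<=` N.
Proof.
move=> NM MSN MNS y My; have [l Nl Sly] := MNS y My.
rewrite -(mulVKg l y); apply: cnsM => //; apply: MSN; split=> //.
by apply: cnsM => //; apply/cnsV/NM.
Qed.

(** M/(M `&` S) is finite and nontrivial, so the closed normal subgroups between
    M `&` S and M include a maximal proper one. It is found by maximizing the
    number of cosets of S met, which replaces Zorn's lemma. *)
Lemma max_normal_below_above (H : topologicalGroupType)
    (M S : closed_normal_subgroup H) :
  compact [set: H] -> nbhs 1 S -> ~ (M `<=` S) ->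
  exists2 N, max_normal_below M N & M `&` S `<=` N.
Proof.
move=> cH S1 MS.
have [n [c [cn cP]]] := coset_counting cH S1.
pose between L := cns_set L `<` M /\ M `&` S `<=` L.
pose P k := `[< exists2 L : closed_normal_subgroup H, between L & c L = k >].
have exP : exists k, P k.
  (* M `&` S itself is a candidate, because M is not contained in S. *)
  exists (c (cns_meet M S)); apply/asboolP; exists (cns_meet M S) => //.
  by split=> //; split=> [y []//|MMS]; apply: MS => y /MMS[].
have Pn k : P k -> (k <= n)%N by move=> /asboolP[L _ <-].
case: (ex_maxnP exP Pn) => k /asboolP[N [NM MSN] <-] Nmax.
exists N => //; split=> // L LM NL; apply/seteqP; split=> //.
have MSL : M `&` S `<=` L by exact: subset_trans NL.
apply: (@cns_modular _ L N S) => //.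
  by move=> y [Ly Sy]; apply: MSN; split=> //; case: LM => + _; apply.
apply: (cP _ _ NL).2; apply: Nmax; apply/asboolP.
by exists L.
Qed.

Lemma fundament_kernel_cofinal (H G : profiniteGroupType) (f : topGroupHom H G)
    (S : closed_normal_subgroup H) :
  nbhs 1 S -> exists n, fundament_kernel f n `<=` S.
Proof.
move=> S1; have cH := @profinite_compact H.
have [n [c [cn cP]]] := coset_counting cH S1.
pose P k := `[< exists i, c (fundament_kernel f i) = k >].
have exP : exists k, P k.
  by exists (c (fundament_kernel f 0)); apply/asboolP; exists 0%N.
(* From the index i where the least number of cosets is met, the series can no
   longer shrink modulo S. *)
case: (ex_minnP exP) => k /asboolP[i <-] imin.
exists i; apply: contrapT => MS.
have [N [[NM MN] maxN] MSN] := max_normal_below_above cH S1 MS.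
apply: (MN); apply: (@cns_modular _ _ _ S) => // y My.
have sub := @fundament_kernel_decr _ _ f i i.+1 (leqnSn i).
have [|l Ml Sl] := (cP _ _ sub).2 _ y My.
  by apply: imin; apply/asboolP; exists i.+1.
by exists l => //; case: Ml => _; apply; split.
Qed.

(** * The inverse limit of the quotients *)

Lemma topgroup_isomorphism_inverse (G H : topologicalGroupType)
    (f : topGroupHom G H) (g : H -> G) :
  cancel f g -> cancel g f -> continuous g -> topgroup_isomorphism f.
Proof.
move=> fg gf cg.
have gM : monoid_morphism g.
  split=> [|x y]; apply: (can_inj fg); first by rewrite gf gmulf1.
  by rewrite gf [RHS]gmulfM; congr (_ * _); rewrite [RHS]gf.
pose gm := isUMagmaMorphism.Build _ _ g gM.
pose gc := isContinuous.Build _ _ g cg.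
pose g' : topGroupHom H G := HB.pack g gm gc.
by exists g'.
Qed.

Section QuotientLimit.
Context (H : profiniteGroupType) (M : nat -> closed_normal_subgroup H).
Context (decrM : forall i j, (i <= j)%N -> M j `<=` M i).
Hypothesis cofinalM : forall S : closed_normal_subgroup H, nbhs 1 S ->
  exists n, M n `<=` S.

Lemma cofinal_bigcap : \bigcap_(i in [set: nat]) cns_set (M i) = [set 1].
Proof.
apply/seteqP; split=> [x Mx|_ -> i _]; last exact: cns1.
apply/esym; apply: (@profinite_hausdorff H) => A B A1 Bx.
have [S [S1 SA]] := open_normal_subgroup_basis A1.
have [n MS] := cofinalM S1.
by exists x; split; [apply/SA/MS/Mx|exact: nbhs_singleton].
Qed.

(** Representatives r i of the coordinates satisfy r j \in r i (M i) for
    j >= i. As this coset of M i is closed, it contains every cluster point of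
    the sequence r. *)
Lemma to_inverse_limit_surj (y : inverse_limit (quotient_system decrM)) :
  exists h, to_inverse_limit decrM h = y.
Proof.
pose r i := repr ((\val y : prod_topology _) i : quotient_group (M i)).
have rE i : coset_map (M i) (r i) = inverse_limit_proj i y by exact: reprK.
have yP i j (ij : (i <= j)%N) : cns_set (M i) ((r i)^-1 * r j).
  apply/coset_mapP; rewrite rE -(quotient_mapE (decrM ij)) rE.
  exact/esym/(set_mem (valP y) i j ij).
have [|h [_ hP]] := @profinite_compact H (r @ \oo) _.
  exact: filterT.
exists h; apply: val_inj; apply: functional_extensionality_dep => i.
rewrite -[RHS](rE i); apply/esym/coset_mapP.
have cC : closed [set g | cns_set (M i) ((r i)^-1 * g)].
  apply: (@closed_comp _ _ (fun g => (r i)^-1 * g)); last exact: cns_closed.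
  by move=> g _; exact: mulg_continuousr.
apply: cC => V Vh; apply: hP Vh.
by exists i => // j /= ij; exact: yP.
Qed.

(** To see that the inverse map is continuous at the image y of h, pick S with
    h S inside the given neighbourhood and n with M n <= S. The families whose
    n-th coordinate is the class of an element of h S form a neighbourhood of
    y, and they come from elements of h S (M n) = h S. *)
Lemma to_inverse_limit_isomorphism :
  topgroup_isomorphism (to_inverse_limit decrM).
Proof.
have inj : injective (to_inverse_limit decrM).
  move=> x y xy; apply: (mulgI x^-1); rewrite mulVg; apply/esym.
  suff : [set 1] (x^-1 * y) by [].
  rewrite -cofinal_bigcap => i _; apply/coset_mapP.
  exact: (congr1 (inverse_limit_proj i) xy).
have [g gf] := choice to_inverse_limit_surj.
have fg : cancel (to_inverse_limit decrM) g by move=> x; apply: inj.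
apply: (topgroup_isomorphism_inverse fg gf) => y U gyU.
have [S [S1 SU]] : exists S : closed_normal_subgroup H,
    nbhs 1 S /\ S `<=` [set s | U (g y * s)].
  by apply: open_normal_subgroup_basis; apply: mulg_continuousr; rewrite mulg1.
have [n MS] := cofinalM S1.
have : nbhs (inverse_limit_proj n y)
    (coset_map (M n) @` [set z | cns_set S ((g y)^-1 * z)]).
  by rewrite -{1}(gf y); apply: coset_map_nbhs; exact: coset_nbhs.
move=> /(@inverse_limit_proj_continuous (quotient_system decrM) n).
rewrite !nbhs_simpl /=; apply: filterS => z /= [w Sw wz].
have Mz : cns_set (M n) (w^-1 * g z).
  by apply/coset_mapP; rewrite wz -{1}(gf z).
suff /SU : cns_set S ((g y)^-1 * g z) by rewrite /= mulVKg.
have := cnsM Sw (MS _ Mz).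
by rewrite -mulgA mulVKg.
Qed.

End QuotientLimit.

Theorem proposition9p2 (H G : profiniteGroupType) (pi : topGroupHom H G)
    (pi_epi : set_surj [set: H] [set: G] pi) :
  \bigcap_(i in [set: nat]) cns_set (fundament_kernel pi i) = [set 1] /\
  topgroup_isomorphism (to_inverse_limit (fundament_kernel_decr pi)).
Proof.
split; first by apply: cofinal_bigcap => S; exact: fundament_kernel_cofinal.
by apply: to_inverse_limit_isomorphism => S; exact: fundament_kernel_cofinal.
Qed.
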